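(* Let $g$ be a value function that is symmetric, monotone, continuous, and satisfies the extended diminishing returns property, with utility $u(S)=\mathbb{E}[g(\mathbf X_S)]$. Suppose the item costs are $\beta$-small or $\beta$-regular for some $\beta\in[0,\tfrac12]$, and the estimates $\hat r_i$ and $\epsilon\in[0,1)$ satisfy the $\epsilon$-accuracy condition. Let $A$ be the output of Algorithm 1. Then $$u(A)\geq \frac{(1-\epsilon)p}{(1-\epsilon)p+q}\,u(OPT),\qquad p=1-1/e,\quad q=\Big(4+\frac{3\beta}{1-\beta}\Big)\Big(1+\frac{\beta}{1-2\beta}\Big).$$
   Context: Items $[n]=\{1,\dots,n\}$; item $i$ has a nonnegative random value $X_i\sim P_i$, and $X_1,\dots,X_n$ are independent. A value function is a function $g:\mathbb{R}_+^m\to\mathbb{R}_+$ with $m\ge n$; it is symmetric if invariant under permutations of coordinates. For $\mathbf x\in\mathbb{R}_+^\ell$ with $\ell\le m$ set $g(\mathbf x):=g(\mathbf x,0,\dots,0)$. For $S\subseteq[n]$, $u(S):=\mathbb{E}[g(\mathbf X_S)]$ where $\mathbf X_S$ has entries $X_i$, $i\in S$. $\mathbf x$ is a subvector of $\mathbf y$ if the entries of $\mathbf x$ appear as a subset of those of $\mathbf y$. $g$ is monotone if $g(\mathbf x)\le g(\mathbf y)$ whenever $\mathbf x$ is a subvector of $\mathbf y$; diminishing returns: $g(\mathbf x,z)-g(\mathbf x)\ge g(\mathbf y,z)-g(\mathbf y)$ for all $z\ge0$, $\mathbf x$ subvector of $\mathbf y$; extended diminishing returns: diminishing returns and, for every $v\ge0$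 in the image of $g$, some $\mathbf y\in\mathbb{R}_+^{m-1}$ has $g(\mathbf y)=v$ and $g(\mathbf x,z)-g(\mathbf x)\ge g(\mathbf y,z)-g(\mathbf y)$ for all $z\ge0$ and all $\mathbf x$ with $g(\mathbf x)\le v$. Costs $0<c_i\le B$, budget $B>0$, $c(S)=\sum_{i\in S}c_i$; $OPT$ maximizes $u(S)$ subject to $c(S)\le B$. $k_i=\lfloor B/c_i\rfloor$; replication test score $r_i=\mathbb{E}[g(X_i^{(1)},\dots,X_i^{(k_i)})]$ with independent copies $X_i^{(j)}$ of $X_i$. Costs are $\beta$-small if $c_i\le\beta B$ for all $i$, and $\beta$-regular if $k_i\ge(1-\beta)k_j$ for all $i,j\in[n]$. Algorithm 1: given estimates $\hat r_i$, relabel so that $\hat r_1\ge\dots\ge\hat r_n$, let $k$ satisfy $c_1+\dots+c_k\le B<c_1+\dots+c_{k+1}$ (assumed to exist). $\epsilon$-accuracy condition: $r_1,\dots,r_{k+1}\ge(1-\epsilon)\max\{r_i:i\in[n]\setminus[k]\}$. $S^*$ starts as $\{1,\dots,k\}$ and for $i=k+2,\dots,n$ in order adds $i$ if the cost stays $\le B$; $S^{**}$ starts as $\{k+1\}$ and for $i=1,\dots,k,k+2,\dots,n$ in order adds $i$ if the cost stays $\le B$; output $A$ is the one of $S^*,S^{**}$ with larger utility.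
   Formalization: The value function g is taken on vectors of every length, with its properties required in every dimension m ≥ n: for one fixed m, r_i is undefined when k_i > m, and the bound can fail even if all k_i ≤ m. For β = 1/2, q is read as +∞ and the ratio as 0. *)

(* Defs.v *)
From HB Require Import structures.
From mathcomp Require Export all_boot all_order all_algebra all_fingroup.
From mathcomp Require Export all_classical all_reals all_analysis.

Set Implicit Arguments.
Unset Strict Implicit.
Unset Printing Implicit Defensive.

Import Order.TTheory GRing.Theory Num.Theory.
Import numFieldNormedType.Exports.

Local Open Scope classical_set_scope.
Local Open Scope ring_scope.

(* A vector of R_+^l is a sequence of size l with nonnegative entries, and
   (x, z) is [rcons x z].  A value function is a function g of vectors of any
   length, the values g x and g (x, 0, ..., 0) being identified by
   [zero_padding]; its values on vectors with a negative entry are irrelevant.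
   The predicates indexed by m are the properties of g as a function on R_+^m,
   where a vector of size at most m stands for its padding by zeros. *)
Section ValueFunctions.
Variable R : realType.
Implicit Types (g : seq R -> R) (x y : seq R) (m : nat).

Definition nonneg_vec x : Prop := forall t, t \in x -> 0 <= t.

Definition nonneg_valued g : Prop := forall x, nonneg_vec x -> 0 <= g x.

Definition zero_padding g : Prop :=
  forall x l, nonneg_vec x -> g (x ++ nseq l 0) = g x.

Definition restrict g m : 'rV[R]_m -> R :=
  fun v => g [seq v ord0 i | i <- enum 'I_m].

(* entries are counted with multiplicity *)
Definition subvector x y : Prop := exists2 s, subseq s y & perm_eq x s.

Definition symmetric_value m g : Prop :=
  forall (s : 'S_m) (v : 'rV[R]_m), (forall i, 0 <= v ord0 i) ->
    restrict g (col_perm s v) = restrict g v.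

Definition continuous_value m g : Prop :=
  {within [set v : 'rV[R]_m | forall i, 0 <= v ord0 i],
    continuous (@restrict g m)}.

Definition monotone_value m g : Prop :=
  forall x y, nonneg_vec y -> (size y <= m)%N -> subvector x y -> g x <= g y.

Definition diminishing_returns m g : Prop :=
  forall x y z, nonneg_vec y -> (size y < m)%N -> 0 <= z -> subvector x y ->
    g (rcons y z) - g y <= g (rcons x z) - g x.

Definition extended_diminishing_returns m g : Prop :=
  diminishing_returns m g /\
  forall v : R, (exists x, [/\ size x = m, nonneg_vec x & g x = v]) ->
    exists y, [/\ size y = m.-1, nonneg_vec y, g y = v &
      forall x z, nonneg_vec x -> (size x < m)%N -> 0 <= z -> g x <= v ->
        g (rcons y z) - g y <= g (rcons x z) - g x].

End ValueFunctions.

Section Probability.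
Context (d : measure_display) (T : measurableType d) (R : realType).
Variable P : probability T R.

Definition mutually_independent (I : finType) (X : I -> {RV P >-> R}) : Prop :=
  forall (J : {set I}) (E : I -> set R), (forall i, measurable (E i)) ->
    P (\bigcap_(i in [set i | i \in J]) (X i @^-1` E i)) =
    (\prod_(i in J) P (X i @^-1` E i))%E.

(* The expectation is taken in [0, +oo]: no integrability is assumed. *)
Definition utility n (X : 'I_n -> {RV P >-> R}) (g : seq R -> R)
    (S : {set 'I_n}) : \bar R :=
  ('E_P[fun w => g [seq X i w | i <- enum S]])%E.

Definition replication_score (Y : nat -> {RV P >-> R}) (g : seq R -> R)
    (k : nat) : \bar R :=
  ('E_P[fun w => g [seq Y j w | j <- iota 0 k]])%E.

End Probability.

Definition independent_copies (d d' : measure_display) (T : measurableType d)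
    (T' : measurableType d') (R : realType) (P : probability T R)
    (Q : probability T' R) (X : {RV P >-> R}) (k : nat)
    (Y : nat -> {RV Q >-> R}) : Prop :=
  [/\ forall j, (j < k)%N -> forall w, 0 <= Y j w,
      forall j, (j < k)%N -> forall E : set R, measurable E ->
        distribution Q (Y j) E = distribution P X E
    & mutually_independent (fun j : 'I_k => Y j)].

Section Budget.
Variables (R : realType) (n : nat) (c : 'I_n -> R) (B : R).

Definition cost (S : {set 'I_n}) : R := \sum_(i in S) c i.

Definition copies (i : 'I_n) : nat := Num.truncn (B / c i).

Definition beta_small (beta : R) : Prop := forall i, c i <= beta * B.

Definition beta_regular (beta : R) : Prop :=
  forall i j, (1 - beta) * (copies j)%:R <= (copies i)%:R.

Definition optimal (u : {set 'I_n} -> \bar R) (O : {set 'I_n}) : Prop :=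
  cost O <= B /\ forall S : {set 'I_n}, cost S <= B -> (u S <= u O)%E.

(* The relabeling is a permutation s: the item with new (0-based) label i is
   [s i].  Thus [k : 'I_n] is both the number k of items of the initial segment
   and the 0-based label of the item k + 1. *)
Definition sorted_by (rhat : 'I_n -> R) (s : 'S_n) : Prop :=
  forall i j : 'I_n, (i <= j)%N -> rhat (s j) <= rhat (s i).

Definition critical_index (s : 'S_n) (k : 'I_n) : Prop :=
  \sum_(i < n | (i < k)%N) c (s i) <= B < \sum_(i < n | (i <= k)%N) c (s i).

Definition accurate (r : 'I_n -> \bar R) (eps : R) (s : 'S_n) (k : 'I_n)
    : Prop :=
  forall i : 'I_n, (i <= k)%N ->
    ((1 - eps)%:E * \big[maxe/-oo]_(j < n | (k <= j)%N) r (s j) <= r (s i))%E.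

Definition greedy_fill (S : {set 'I_n}) (l : seq 'I_n) : {set 'I_n} :=
  foldl (fun S i => if cost (i |: S) <= B then i |: S else S) S l.

Definition S_star (s : 'S_n) (k : 'I_n) : {set 'I_n} :=
  greedy_fill [set s i | i : 'I_n & (i < k)%N]%SET
    [seq s i | i : 'I_n <- enum 'I_n & (k < i)%N].

Definition S_starstar (s : 'S_n) (k : 'I_n) : {set 'I_n} :=
  greedy_fill [set s k]%SET [seq s i | i : 'I_n <- enum 'I_n & i != k].

(* a tie between the two utilities may be broken either way *)
Definition algorithm_output (u : {set 'I_n} -> \bar R) (s : 'S_n) (k : 'I_n)
    (A : {set 'I_n}) : Prop :=
  [/\ A = S_star s k \/ A = S_starstar s k,
      (u (S_star s k) <= u A)%E & (u (S_starstar s k) <= u A)%E].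

End Budget.

Definition p_const (R : realType) : R := 1 - (expR 1)^-1.

(* In \bar R, 1 / 0 = +oo and 1 / +oo = 0; hence q = +oo for beta = 1 / 2, and
   the approximation ratio is then 0. *)
Definition q_const (R : realType) (beta : R) : \bar R :=
  ((4 + 3 * beta / (1 - beta))%:E * (1 + beta%:E / (1 - 2 * beta)%:E))%E.

Definition approx_ratio (R : realType) (eps beta : R) : \bar R :=
  (((1 - eps) * p_const R)%:E /
   (((1 - eps) * p_const R)%:E + q_const beta))%E.

(* Main.v *)
From HB Require Import structures.
Require Import Defs.
From mathcomp Require Import measurable_realfun lra ring.

Set Implicit Arguments.
Unset Strict Implicit.
Unset Printing Implicit Defensive.

Import Order.TTheory GRing.Theory Num.Theory.
Import numFieldNormedType.Exports.

Local Open Scope classical_set_scope.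
Local Open Scope ring_scope.

(* Let e_i(x) = E g(x, X_i), let [k] be the initial segment of the greedy order
   and let t be the largest score r_j of an item j outside [k].

   Lower bound.  If y is the vector given by the extended diminishing returns
   property for v = g(x), then r_i <= E g(y, X_i^(1), ..., X_i^(k_i))
   <= g(x) + k_i (e_i(y) - g(y)) <= g(x) + k_i (e_i(x) - g(x)).  By independence
   r_i + (k_i - 1) u(S) <= k_i u(S + i), whence
   u([k]) >= (1 - eps) t (1 - prod (1 - 1/k_i)), where the product is at most
   exp(- sum 1/k_i) <= exp(- (1 - beta)) <= 1 - (1 - beta) p.

   Upper bound.  Let y be the vector given for v = 2 t, and
   D_i = e_i(y) - v.  Adding the copies of X_i one by one, each step contributes
   at least D_i (1 - r_i / v) >= D_i / 2, so D_i <= 2 t / k_i; hence for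
   O = OPT \ [k], u(O) <= g(y) + sum_O D_i <= 2 t (1 + sum_O 1/k_i)
   <= 2 t (1 + 1 / (1 - beta)).

   Since u(OPT) <= u([k]) + u(O) and u([k]) <= u(S-star) <= u(A), this gives the
   ratio with 2 (2 - beta) / (1 - beta)^2 <= q in place of q; S-star-star plays
   no role. *)

(** * Measurability and intermediate values for functions continuous on a set of vectors *)

(** The set where F exceeds a is a countable union of preimages of boxes with rational centre and
    radius 1 / (p.2 + 1). The boxes kept are the [good] ones, whose points in C all satisfy a < F; C
    itself may be any set. *)
Lemma measurable_continuous_within (R : realType) (d : measure_display)
    (T : measurableType d) (m : nat) (C : set 'rV[R]_m) (F : 'rV[R]_m -> R)
    (f : 'I_m -> T -> R) :
    {within C, continuous F} ->
    (forall i, measurable_fun setT (f i)) ->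
    (forall w, C (\row_i f i w)) ->
  measurable_fun setT (fun w => F (\row_i f i w)).
Proof.
move=> Fc mf Cf; apply: (measurability _ (RGenOInfty.measurableE R)).
move=> _ [_ [a ->] <-]; rewrite setTI.
pose box (p : 'rV[rat]_m * nat) : set T :=
  \bigcap_(i in [set: 'I_m])
    [set w | `|f i w - ratr (p.1 ord0 i)| < p.2.+1%:R^-1].
pose good (p : 'rV[rat]_m * nat) := forall x : 'rV[R]_m, C x ->
  (forall i, `|x ord0 i - ratr (p.1 ord0 i)| < p.2.+1%:R^-1) -> a < F x.
have -> : (fun w => F (\row_i f i w)) @^-1` `]a, +oo[%classic =
    \bigcup_p (if `[< good p >] then box p else set0).
  apply/seteqP; split => [w /=|w [p _]]; last first.
    case: ifPn => // /asboolP gp bw; rewrite /= in_itv/= andbT.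
    by apply: gp => [|i]; [exact: Cf|rewrite mxE; exact: bw].
  rewrite in_itv/= andbT => aF; set x0 := \row_i f i w in aF *.
  have /subspace_continuousP/(_ x0 (Cf w)) Fx0 := Fc.
  have : \forall x \near within C (nbhs x0), a < F x.
    by apply: (Fx0 [set y | a < y]); exact: lt_nbhsr.
  rewrite /within/= nearE /= -nbhs_ballE => -[e /= e0 be].
  (* Twice the radius must be below e: a point of the box and the value at w are both compared with
     the rational centre. *)
  have [k ke] : exists k : nat, k.+1%:R^-1 + k.+1%:R^-1 < e.
    exists (Num.truncn (2 / e)).
    set k := Num.truncn _.
    have : 2 / e < k.+1%:R by exact: truncnS_gt.
    have k0 : 0 < k.+1%:R :> R by rewrite ltr0n.
    rewrite ltr_pdivrMr// => h; rewrite -mulr2n -[_ *+ 2]mulr_natl ltr_pdivrMr//.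
    by rewrite mulrC.
  have qP i : exists q : rat, `|f i w - ratr q| < k.+1%:R^-1.
    have k0 : 0 < k.+1%:R^-1 :> R by rewrite invr_gt0 ltr0n.
    have [q] : exists q : rat, ratr q \in `](f i w - k.+1%:R^-1), (f i w)[.
      by apply: rat_in_itvoo; rewrite ltrBlDr ltrDl.
    rewrite in_itv/= => /andP[q1 q2]; exists q.
    by rewrite gtr0_norm ?subr_gt0// ltrBlDr -ltrBlDl.
  pose q i := projT1 (cid (qP i)).
  have qE i : `|f i w - ratr (q i)| < k.+1%:R^-1 by rewrite /q; case: cid.
  exists (\row_i q i, k) => //; rewrite ifT.
    by move=> i _ /=; rewrite mxE.
  apply/asboolP => x Cx /= xq; apply: (be x) => //; split=> // i j.
  rewrite /ball/= (ord1 i) mxE; apply: le_lt_trans ke.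
  have := xq j; rewrite mxE => xqj.
  rewrite (_ : f j w - _ = (f j w - ratr (q j)) + (ratr (q j) - x ord0 j)); last by ring.
  by rewrite (le_trans (ler_normD _ _))// lerD// ?(distrC (ratr _)) ltW//.
apply: countable_bigcupT_measurable => [|p]; first exact: countableP.
case: ifPn => // _; apply: fin_bigcap_measurable => [|i _].
  exact: finite_finset.
rewrite (_ : [set _ | _] = (fun w => `|f i w - ratr (p.1 ord0 i)|) @^-1`
  `]-oo, p.2.+1%:R^-1[%classic); last by apply/seteqP; split => w /=; rewrite in_itv.
rewrite -[X in measurable X]setTI.
have : measurable_fun setT (fun w => `|f i w - ratr (p.1 ord0 i)|).
  by apply: measurableT_comp => //; exact: measurable_funB.
by apply.
Qed.

(** The intermediate value theorem is applied along the ray through x. The path [|t| *: x] stays in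
    the orthant for every real t, so F is continuous along it on the whole line. *)
Lemma value_intermediate (R : realType) (m : nat) (F : 'rV[R]_m -> R)
    (x : 'rV[R]_m) (v : R) :
    {within [set y : 'rV[R]_m | forall i, 0 <= y ord0 i], continuous F} ->
    (forall i, 0 <= x ord0 i) -> F 0 <= v <= F x ->
  exists2 y : 'rV[R]_m, forall i, 0 <= y ord0 i & F y = v.
Proof.
move=> Fc x0 /andP[F0v vFx].
have norm_ge0 (t : R) i : 0 <= (`|t| *: x) ord0 i by rewrite mxE mulr_ge0.
have phic : continuous (fun t : R => F (`|t| *: x)).
  move=> t; have /subspace_continuousP/(_ _ (norm_ge0 t)) := Fc.
  apply: cvg_comp => A; rewrite /within/= => nA.
  have cx : continuous (fun t : R => `|t| *: x).
    by move=> u; apply: cvgZr_tmp; exact: norm_continuous.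
  by apply: (@filterS _ (nbhs t) _ _ _ _ (cx t _ nA)) => u uA; exact: uA (norm_ge0 u).
have [|t _ tv] := @IVT R _ 0 1 v ler01 (continuous_subspaceT phic).
  by rewrite normr0 scale0r normr1 scale1r min_l ?max_r ?F0v ?vFx// (le_trans F0v).
by exists (`|t| *: x).
Qed.

(** * One variable is independent of a tuple of others *)

Section IndependentCoordinate.
Context (R : realType) (d : measure_display) (T : measurableType d).
Context (P : probability T R) (N : nat) (X : 'I_N -> {RV P >-> R}).
Hypothesis X_indep : mutually_independent X.
Variables (l : seq 'I_N) (j : 'I_N).
Hypotheses (l_uniq : uniq l) (jl : j \notin l).

Let m := size l.
Let V : T -> m.-tuple R := fun w => [tuple X (tnth (in_tuple l) a) w | a < m].

Let V_measurable : measurable_fun setT V.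
Proof.
apply/measurable_fun_tnthP => a.
rewrite (_ : _ \o _ = X (tnth (in_tuple l) a)); first exact: measurable_funPT.
by apply/funext => w /=; rewrite tnth_mktuple.
Qed.

(** Sides are indexed by items rather than by positions, to match [mutually_independent]. Nothing is
    lost because l has no repetition, so a position is determined by its item. *)
Let boxes : set (set (m.-tuple R)) := [set A | exists2 E : 'I_N -> set R,
  (forall i, measurable (E i)) &
  A = [set t : m.-tuple R |
         forall a : 'I_m, E (tnth (in_tuple l) a) (tnth t a)]].

Let measurable_boxes : @measurable _ (m.-tuple R) = <<s boxes >>.
Proof.
apply/seteqP; split; apply: smallest_sub => //.
- rewrite -bigcup_seq => _ [a _ [E mE <-]]; apply: sub_sigma_algebra.
  exists (fun i => if i == tnth (in_tuple l) a then E else setT) => [i|].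
    by case: ifP.
  rewrite setTI; apply/seteqP; split => [t /= Et b|t /= /(_ a)]; last by rewrite eqxx.
  case: ifPn => // /eqP /tuple_uniqP - /(_ l_uniq) ->//.
- exact: sigma_algebra_measurable.
- move=> _ [E mE ->].
  rewrite (_ : [set _ | _] = \bigcap_(a in [set: 'I_m])
      ((fun t : m.-tuple R => tnth t a) @^-1` E (tnth (in_tuple l) a))).
    apply: fin_bigcap_measurable => [|a _]; first exact: finite_finset.
    by rewrite -[X in measurable X]setTI; exact: measurable_tnth.
  by apply/seteqP; split => t /= Et a; [move=> _|]; exact: Et.
Qed.

Let Vm : {mfun T >-> m.-tuple R} :=
  HB.pack V (isMeasurableFun.Build _ _ _ _ V V_measurable).

Let preimage_box (E : 'I_N -> set R) :
  Vm @^-1` [set t : m.-tuple R |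
              forall a : 'I_m, E (tnth (in_tuple l) a) (tnth t a)] =
  \bigcap_(i in [set i | i \in [set i in l]%SET]) (X i @^-1` E i).
Proof.
apply/seteqP; split => w /= Ew.
  move=> i /=; rewrite inE => il.
  have /tnthP[a ai] : i \in in_tuple l by [].
  by have := Ew a; rewrite /= tnth_mktuple -ai.
move=> a; rewrite tnth_mktuple; apply: Ew => /=; rewrite inE.
exact: mem_tnth.
Qed.

(** For fixed F both sides are finite measures in A. They agree on [boxes], which generates the
    sigma-algebra and is stable under intersection, hence they agree everywhere. *)
Let V_indep (A : set (m.-tuple R)) (F : set R) :
    measurable A -> measurable F ->
  P (Vm @^-1` A `&` X j @^-1` F) = (P (Vm @^-1` A) * P (X j @^-1` F))%E.
Proof.
move=> mA mF.
have mXF : measurable (X j @^-1` F) by exact: measurable_funPTI.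
pose r : {nonneg R} := NngNum (fine_ge0 (measure_ge0 P (X j @^-1` F))).
pose m1 : {measure set _ -> \bar R} := pushforward (mrestr P mXF) Vm.
pose m2 : {measure set _ -> \bar R} := mscale r (distribution P Vm).
have rE : (r%:num%:E = P (X j @^-1` F))%E by rewrite /= fineK ?fin_num_measure.
suff : m1 V_measurable A = m2 A.
  by rewrite /m1 /m2 /= /mscale /distribution /pushforward/= /mrestr rE muleC.
apply: (measure_unique boxes (fun=> setT) measurable_boxes) => //.
- move=> _ _ [E mE ->] [E' mE' ->]; exists (fun i => E i `&` E' i).
    by move=> i; exact: measurableI.
  apply/seteqP; split => [t /= [Et Et'] a|t /= EE]; first by split.
  by split => a; have [] := EE a.
- by move=> _; exists (fun=> setT) => //; apply/seteqP; split.
- by rewrite bigcup_const//; exists 0%N.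
- move=> _ [E mE ->].
  rewrite /m1 /m2 /= /mscale rE /distribution /pushforward/= /mrestr.
  rewrite preimage_box -[distribution _ _ _]/(P (Vm @^-1` _)) preimage_box X_indep//.
  (* The event on X_j becomes one more side of the family, so independence over l together with j
     factors it out. *)
  pose E' i := if i == j then F else E i.
  have jS : j \notin [set i in l]%SET by rewrite inE.
  rewrite (_ : _ `&` _ =
      \bigcap_(i in [set i | i \in (j |: [set i in l])%SET]) (X i @^-1` E' i)).
    rewrite X_indep => [|i]; last by rewrite /E'; case: ifP.
    rewrite big_setU1//= /E' eqxx; congr (_ * _)%E; apply: eq_bigr => i il.
    by case: eqP => // ij; rewrite -ij il in jS.
  apply/seteqP; split => [w [/= lw jw] i|w /= lw].
    rewrite /= in_setU1 /E'; case: eqVneq => [->//|_ /= il]; exact: lw.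
  split=> [i /= il|]; last by have := lw j; rewrite /E' eqxx; apply; rewrite /= setU11.
  have := lw i; rewrite /= /E' in_setU1 il orbT; case: eqP => [ij|_]; last exact.
  by rewrite ij (negPf jS) in il.
- by move=> _; rewrite (le_lt_trans _ (ltry 1))//= /pushforward/= /mrestr preimage_setT setTI probability_le1.
Qed.

(** By [V_indep] the joint law is the product of the two laws, and Tonelli's theorem separates the
    integrals. *)
Lemma integral_indep (f : m.-tuple R * R -> \bar R) :
    measurable_fun setT f -> (forall t, 0 <= f t)%E ->
  (\int[P]_w f ([tuple X (tnth (in_tuple l) a) w | a < m], X j w) =
   \int[P]_w \int[distribution P (X j)]_z
     f ([tuple X (tnth (in_tuple l) a) w | a < m], z))%E.
Proof.
move=> mf f0.
have mVX : measurable_fun setT (fun w => (Vm w, X j w)).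
  by apply/measurable_fun_pairP; split; exact: measurable_funPT.
pose VX : {mfun T >-> (m.-tuple R * R)%type} :=
  HB.pack (fun w => (Vm w, X j w)) (isMeasurableFun.Build _ _ _ _ _ mVX).
transitivity (\int[distribution P VX]_t f t)%E.
  by rewrite ge0_integral_pushforward//.
transitivity (\int[(distribution P Vm \x distribution P (X j))%E]_t f t)%E.
  apply: eq_measure_integral => A mA _; apply/esym.
  apply: product_measure_unique mA => A1 A2 mA1 mA2.
  by have := V_indep mA1 mA2.
rewrite fubini_tonelli1// ge0_integral_pushforward//.
  exact: measurable_fun_fubini_tonelli_F.
by move=> t _; apply: integral_ge0.
Qed.

End IndependentCoordinate.

(** * Value functions extended to all real vectors *)

(* The properties of a value function with neither a bound on the dimension nor
   a sign condition on the entries; [total_value_pos] reduces to this case by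
   replacing g with its composition with the positive part. *)
Record total_value_function (R : realType) (h : seq R -> R) : Prop := {
  tv_ge0 : forall x, 0 <= h x;
  tv_mono : forall x y, subvector x y -> h x <= h y;
  tv_dr : forall x y z, subvector x y ->
    h (rcons y z) + h x <= h (rcons x z) + h y;
  tv_edr : forall (N : nat) x0, exists y, h y = h x0 /\
    forall x z, (size x <= N)%N -> h x <= h x0 ->
      h (rcons y z) + h x <= h (rcons x z) + h y;
  tv_ivt : forall x v, h [::] <= v <= h x -> exists y, h y = v;
  tv_measurable : forall (d : measure_display) (T : measurableType d)
    (I : Type) (l : seq I) (f : I -> T -> R),
    (forall i, measurable_fun setT (f i)) ->
    measurable_fun setT (fun w => h [seq f i w | i <- l]) }.

Section PositivePart.
Variable R : realType.
Implicit Types (x y : seq R) (g : seq R -> R).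

Definition pos_vec x : seq R := [seq Num.max 0 t | t <- x].

Lemma pos_vec_nonneg x : nonneg_vec (pos_vec x).
Proof. by move=> t /mapP[u _ ->]; rewrite le_max lexx. Qed.

Lemma pos_vec_id x : nonneg_vec x -> pos_vec x = x.
Proof. by move=> x0; apply: map_id_in => t /x0 t0; exact: max_r. Qed.

Lemma pos_vec_subvector x y : subvector x y -> subvector (pos_vec x) (pos_vec y).
Proof.
move=> [s sy xs]; exists (pos_vec s); first exact: map_subseq.
exact: perm_map.
Qed.

Lemma pos_vec_rcons x z : pos_vec (rcons x z) = rcons (pos_vec x) (Num.max 0 z).
Proof. exact: map_rcons. Qed.

Lemma restrict_row g x (m : nat) : zero_padding g -> nonneg_vec x ->
  (size x <= m)%N -> restrict g (\row_(i < m) nth 0 x i) = g x.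
Proof.
move=> g_pad x0 xm; rewrite -(g_pad x (m - size x)%N x0) /restrict.
congr g; rewrite (eq_map (g := nth 0 x \o val)); last by move=> i; rewrite mxE.
rewrite map_comp val_enum_ord; apply: (@eq_from_nth _ 0).
  by rewrite size_map size_iota size_cat size_nseq subnKC.
move=> i; rewrite size_map size_iota => im.
rewrite (nth_map 0%N) ?size_iota// nth_iota// add0n nth_cat nth_nseq if_same.
by case: ltnP => // xi; rewrite nth_default.
Qed.

Lemma nonneg_row x (m : nat) : nonneg_vec x ->
  forall i, 0 <= (\row_(i < m) nth 0 x i) ord0 i.
Proof.
move=> x0 i; rewrite mxE; have [ix|xi] := ltnP i (size x).
  by apply: x0; exact: mem_nth.
by rewrite nth_default.
Qed.

Lemma nonneg_padding x (l : nat) : nonneg_vec x -> nonneg_vec (x ++ nseq l 0).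
Proof. by move=> x0 t; rewrite mem_cat mem_nseq => /orP[/x0//|/andP[_ /eqP->]]. Qed.

(** Each field concerns vectors of bounded size, so it follows from the property of g in one
    dimension m above n and those sizes. The witness of extended diminishing returns depends on m,
    whence the bound N in [tv_edr]. *)
Lemma total_value_pos g (n : nat) :
    nonneg_valued g -> zero_padding g ->
    (forall m : nat, (n <= m)%N -> monotone_value m g) ->
    (forall m : nat, (n <= m)%N -> continuous_value m g) ->
    (forall m : nat, (n <= m)%N -> extended_diminishing_returns m g) ->
  total_value_function (g \o pos_vec).
Proof.
move=> g_ge0 g_pad g_mono g_cont g_edr.
have le0 (z : R) : 0 <= Num.max 0 z by rewrite le_max lexx.
split=> /=.
- by move=> x; apply: g_ge0; exact: pos_vec_nonneg.
- move=> x y /pos_vec_subvector xy.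
  by apply: (g_mono _ (leq_maxl n (size (pos_vec y)))) => //;
    [exact: pos_vec_nonneg|exact: leq_maxr].
- move=> x y z /pos_vec_subvector xy; rewrite !pos_vec_rcons.
  have [+ _] := g_edr _ (leq_maxl n (size (pos_vec y)).+1).
  move=> /(_ _ _ (Num.max 0 z) (@pos_vec_nonneg y)).
  by move=> /(_ _ (leq_maxr _ _) (le0 z) xy); lra.
- move=> N x0; pose m := maxn (maxn n (size (pos_vec x0))) N.+1.
  have nm : (n <= m)%N by rewrite !leq_max leqnn.
  have xm : (size (pos_vec x0) <= m)%N by rewrite !leq_max leqnn orbT.
  have Nm : (N < m)%N by rewrite !leq_max leqnn orbT.
  have [_ /(_ (g (pos_vec x0)))[]] := g_edr _ nm.
    exists (pos_vec x0 ++ nseq (m - size (pos_vec x0)) 0); split.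
    + by rewrite size_cat size_nseq subnKC.
    + exact/nonneg_padding/pos_vec_nonneg.
    + by rewrite g_pad//; exact: pos_vec_nonneg.
  move=> y [_ y0 gy yP]; exists y; rewrite pos_vec_id//; split=> // x z xN xx0.
  rewrite !pos_vec_rcons (pos_vec_id y0).
  have := yP (pos_vec x) (Num.max 0 z) (@pos_vec_nonneg x).
  by rewrite size_map (leq_ltn_trans xN)// => /(_ erefl (le0 z) xx0); lra.
- move=> x v; pose m := maxn n (size (pos_vec x)).
  have nm : (n <= m)%N by rewrite leq_max leqnn.
  have xm : (size (pos_vec x) <= m)%N by rewrite leq_max leqnn orbT.
  have rowx := @restrict_row g _ _ g_pad (@pos_vec_nonneg x) xm.
  have row0 : restrict g (0 : 'rV[R]_m) = g [::].
    rewrite -[RHS](@restrict_row g [::] m g_pad) //; congr (restrict g _).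
    by apply/rowP => i; rewrite !mxE nth_nil.
  rewrite -rowx -row0 => /(value_intermediate (g_cont _ nm) _)[].
    exact/nonneg_row/pos_vec_nonneg.
  move=> y y0 yv; exists [seq y ord0 i | i <- enum 'I_m].
  by rewrite pos_vec_id// => _ /mapP[i _ ->].
- move=> d T I l f mf; pose m := maxn n (size l).
  have nm : (n <= m)%N by rewrite leq_max leqnn.
  have lm w : (size (pos_vec [seq f i w | i <- l]) <= m)%N.
    by rewrite !size_map leq_max leqnn orbT.
  rewrite (_ : (fun w => _) = fun w =>
    restrict g (\row_(a < m) nth 0 (pos_vec [seq f i w | i <- l]) a)); last first.
    apply/funext => w; rewrite restrict_row//; exact: pos_vec_nonneg.
  apply: (measurable_continuous_within
    (f := fun a w => nth 0 (pos_vec [seq f i w | i <- l]) a) (g_cont _ nm)).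
    move=> a; have [al|la] := ltnP a (size l); last first.
      rewrite (_ : (fun w => _) = cst 0)//.
      by apply/funext => w; rewrite nth_default// !size_map.
    pose i0 := tnth (in_tuple l) (Ordinal al).
    rewrite (_ : (fun w => _) = fun w => Num.max 0 (f (nth i0 l a) w)).
      exact: measurable_maxr.
    by apply/funext => w; rewrite (nth_map 0) ?size_map// (nth_map i0).
  by move=> w i; apply: nonneg_row; exact: pos_vec_nonneg.
Qed.

End PositivePart.

(** * Comparison of integrals, and subvectors *)

(** Integrals may be +oo, so inequalities between increments are kept in additive form, with a
    constant added on each side instead of subtracted. *)
Lemma le_integralD_cst (R : realType) (d : measure_display)
    (T : measurableType d) (P : probability T R) (f1 f2 : T -> \bar R)
    (a b : R) :
    measurable_fun setT f1 -> measurable_fun setT f2 ->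
    (forall w, 0 <= f1 w)%E -> (forall w, 0 <= f2 w)%E ->
    0 <= a -> 0 <= b -> (forall w, f1 w + a%:E <= f2 w + b%:E)%E ->
  (\int[P]_w f1 w + a%:E <= \int[P]_w f2 w + b%:E)%E.
Proof.
move=> mf1 mf2 f1_ge0 f2_ge0 a0 b0 f12.
have cstE (r : R) : (\int[P]_w cst r%:E w = r%:E)%E.
  by rewrite integral_cst//= probability_setT mule1.
rewrite -(cstE a) -(cstE b) -!ge0_integralD//=.
apply: ge0_le_integral => //=; try exact: emeasurable_funD.
by move=> w _; rewrite adde_ge0.
Qed.

Section Subvector.
Variable R : realType.
Implicit Types x y z : seq R.

Lemma perm_subvector x y : perm_eq x y -> subvector x y.
Proof. by exists y. Qed.

Lemma subvector_catl x y : subvector x (x ++ y).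
Proof. by exists x => //; exact: prefix_subseq. Qed.

Lemma subvector_catr x y : subvector y (x ++ y).
Proof. by exists y => //; exact: suffix_subseq. Qed.

Lemma subvector_enum (I : finType) (A B : {set I}) (f : I -> R) :
  A \subset B -> subvector [seq f i | i <- enum A] [seq f i | i <- enum B].
Proof.
move=> AB; exists [seq f i | i <- enum A] => //; apply: map_subseq.
have -> : enum A = [seq i <- enum B | i \in A].
  rewrite /enum_mem -filter_predI; apply: eq_filter => i /=.
  by case: (boolP (i \in A)) => //= /(fintype.subsetP AB) ->.
exact: filter_subseq.
Qed.

End Subvector.

(** * Increments of a value function and their expectations *)

Section TotalValue.
Variables (R : realType) (h : seq R -> R).
Hypothesis h_total : total_value_function h.
Implicit Types x y : seq R.

Lemma tv_perm x y : perm_eq x y -> h x = h y.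
Proof.
move=> xy; apply/le_anti; rewrite !(tv_mono h_total)//; apply: perm_subvector => //.
by rewrite perm_sym.
Qed.

Lemma tv_le_rcons x z : h x <= h (rcons x z).
Proof. by rewrite -cats1; apply: (tv_mono h_total); exact: subvector_catl. Qed.

(** Append the entries of x to y one at a time: by diminishing returns each increment is at most the
    one over y alone. The subtractions of h y are cleared. *)
Lemma tv_cat_le y x :
  h (y ++ x) + (size x)%:R * h y <= h y + \sum_(z <- x) h (rcons y z).
Proof.
elim/last_ind: x => [|x z IH]; first by rewrite cats0 big_nil mul0r.
rewrite -rcons_cat size_rcons -[in \sum_(_ <- _) _]cats1 big_cat big_seq1/=.
have := tv_dr h_total z (subvector_catl y x).
by rewrite mulrS mulrDl mul1r; lra.
Qed.

(** Diminishing returns compares each increment over x ++ y with the one over y; the induction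
    starts from 0 <= h [::]. *)
Lemma tv_subadditive x y : h (x ++ y) <= h x + h y.
Proof.
elim/last_ind: y => [|y z IH]; first by rewrite cats0 lerDl (tv_ge0 h_total).
rewrite -rcons_cat; have := tv_dr h_total z (subvector_catr x y); lra.
Qed.

Lemma tv_measurableE (d : measure_display) (T : measurableType d) (I : Type)
    (l : seq I) (f : I -> T -> R) :
    (forall i, measurable_fun setT (f i)) ->
  measurable_fun setT (fun w => (h [seq f i w | i <- l])%:E).
Proof. by move=> mf; apply/measurable_EFinP; exact: tv_measurable. Qed.

Lemma tv_measurable_rcons (d : measure_display) (T : measurableType d)
    (I : Type) (l : seq I) (f : I -> T -> R) (z : T -> R) :
    (forall i, measurable_fun setT (f i)) -> measurable_fun setT z ->
  measurable_fun setT (fun w => (h (rcons [seq f i w | i <- l] (z w)))%:E).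
Proof.
move=> mf mz.
(* The appended entry becomes an extra index [None], so [tv_measurable] applies to a single
   family. *)
pose F (o : option I) w := if o is Some i then f i w else z w.
rewrite (_ : (fun w => _) = fun w =>
    (h [seq F o w | o <- rcons [seq Some i | i <- l] None])%:E).
  by apply: tv_measurableE => -[i|] /=; [exact: mf|exact: mz].
by apply/funext => w; rewrite map_rcons -map_comp.
Qed.

Lemma tv_measurable_rcons_cst x :
  measurable_fun setT (fun z : R => (h (rcons x z))%:E).
Proof.
rewrite -[x]map_id.
by apply: (@tv_measurable_rcons _ _ R x (fun t _ => t) id) => // i;
  exact: measurable_cst.
Qed.

Section Law.
Variable mu : probability R R.

(** This is e_i(x) when mu is the law of X_i; it may be +oo. *)
Definition next_value x : \bar R := (\int[mu]_z (h (rcons x z))%:E)%E.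

Lemma next_value_ge x : ((h x)%:E <= next_value x)%E.
Proof.
have -> : (h x)%:E = (\int[mu]_z cst (h x)%:E z)%E.
  by rewrite integral_cst//= probability_setT mule1.
apply: ge0_le_integral => //=.
- by move=> z _; rewrite lee_fin (tv_ge0 h_total).
- exact: tv_measurable_rcons_cst.
- by move=> z _; rewrite lee_fin tv_le_rcons.
Qed.

Lemma next_value_le x y :
    (forall z, h (rcons y z) + h x <= h (rcons x z) + h y) ->
  (next_value y + (h x)%:E <= next_value x + (h y)%:E)%E.
Proof.
move=> hyx; apply: le_integralD_cst.
- exact: tv_measurable_rcons_cst.
- exact: tv_measurable_rcons_cst.
- by move=> z; rewrite lee_fin (tv_ge0 h_total).
- by move=> z; rewrite lee_fin (tv_ge0 h_total).
- exact: tv_ge0.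
- exact: tv_ge0.
- by move=> z; rewrite -!EFinD lee_fin.
Qed.

Lemma next_value_measurable (d : measure_display) (T : measurableType d)
    (I : Type) (l : seq I) (f : I -> T -> R) :
    (forall i, measurable_fun setT (f i)) ->
  measurable_fun setT (fun w => next_value [seq f i w | i <- l]).
Proof.
move=> mf.
apply: (@measurable_fun_fubini_tonelli_F _ _ _ _ _ mu
  (fun wz : T * R => (h (rcons [seq f i wz.1 | i <- l] wz.2))%:E)).
  by apply: tv_measurable_rcons => // i; exact: measurableT_comp.
by move=> wz; rewrite lee_fin (tv_ge0 h_total).
Qed.

(** Applied both to adding an item to a set of items and to adding a copy to the earlier copies of
    the same item; in the second case mu is the law of the original item. *)
Lemma integral_rcons_indep (d : measure_display) (T : measurableType d)
    (P : probability T R) (N : nat) (X : 'I_N -> {RV P >-> R})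
    (l : seq 'I_N) (j : 'I_N) :
    mutually_independent X -> uniq l -> j \notin l ->
    (forall E : set R, measurable E -> distribution P (X j) E = mu E) ->
  (\int[P]_w (h (rcons [seq X i w | i <- l] (X j w)))%:E =
   \int[P]_w next_value [seq X i w | i <- l])%E.
Proof.
move=> X_indep l_uniq jl Xj_law.
pose f (tz : (size l).-tuple R * R) : \bar R :=
  (h (rcons [seq tnth tz.1 a | a <- enum 'I_(size l)] tz.2))%:E.
have mf : measurable_fun setT f.
  apply: tv_measurable_rcons => // a.
  apply: (measurableT_comp (measurable_tnth a)) => //.
have tupleE w z : f ([tuple X (tnth (in_tuple l) a) w | a < size l], z) =
    (h (rcons [seq X i w | i <- l] z))%:E.
  rewrite /f /=; congr (h (rcons _ _))%:E.
  rewrite (eq_map (g := (fun i => X i w) \o tnth (in_tuple l))).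
    by rewrite map_comp map_tnth_enum.
  by move=> a; rewrite tnth_mktuple.
have f0 t : (0 <= f t)%E by rewrite lee_fin (tv_ge0 h_total).
have := integral_indep X_indep l_uniq jl mf f0.
under eq_integral do rewrite tupleE.
move=> ->; apply: eq_integral => w _.
under eq_integral do rewrite tupleE.
by apply: eq_measure_integral => E mE _; exact: Xj_law.
Qed.

(** * Replication scores against expected increments *)

Section Replication.
Context (d : measure_display) (T : measurableType d) (Q : probability T R).
Variables (Z : nat -> {RV Q >-> R}) (k : nat).
Hypothesis Z_law : forall j, (j < k)%N -> forall E : set R, measurable E ->
  distribution Q (Z j) E = mu E.

Let score (j : nat) : \bar R := (\int[Q]_w (h [seq Z i w | i <- iota 0 j])%:E)%E.

Lemma integral_next_value x j : (j < k)%N ->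
  (\int[Q]_w (h (rcons x (Z j w)))%:E = next_value x)%E.
Proof.
move=> jk; transitivity (\int[distribution Q (Z j)]_z (h (rcons x z))%:E)%E.
  rewrite ge0_integral_pushforward//; first exact: tv_measurable_rcons_cst.
  by move=> z _; rewrite lee_fin (tv_ge0 h_total).
by apply: eq_measure_integral => E mE _; exact: Z_law.
Qed.

(** Take y of value h x from extended diminishing returns. Prepending y to the copies only increases
    the value, and [tv_cat_le] then bounds it by a sum with one term per copy, each of expectation
    [next_value y]. Finally the increment over y is at most the one over x. *)
Lemma score_le_next_value x : (0 < k)%N ->
  (score k + (k.-1%:R * h x)%:E <= k%:R%:E * next_value x)%E.
Proof.
move=> k0; have [y [hy yP]] := tv_edr h_total (size x) x.
apply: (@le_trans _ _ (k%:R%:E * next_value y)%E); last first.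
  apply: lee_wpmul2l; first by rewrite lee_fin.
  have := @next_value_le x y (fun z => yP x z (leqnn _) (lexx _)).
  by rewrite hy leeD2rE.
have -> : (k%:R%:E * next_value y = \int[Q]_w
    (\sum_(j <- iota 0 k) (h (rcons y (Z j w)))%:E)%E)%E.
  rewrite ge0_integral_sum//; last 2 first.
    move=> j; rewrite -[y]map_id.
    by apply: (@tv_measurable_rcons _ _ R y (fun t _ => t)) => // i;
      exact: measurable_cst.
    by move=> j w _; rewrite lee_fin (tv_ge0 h_total).
  rewrite (eq_big_seq (fun=> next_value y)); last first.
    by move=> j; rewrite mem_iota add0n => /integral_next_value.
  by rewrite big_const_seq count_predT size_iota iter_addr_0 mule_natl.
rewrite -[leRHS]adde0; apply: le_integralD_cst => //.
- by apply: tv_measurableE => i; exact: measurable_funPT.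
- apply: emeasurable_sum => j _; rewrite -[y]map_id.
  by apply: (@tv_measurable_rcons _ _ R y (fun t _ => t)) => // i;
    exact: measurable_cst.
- by move=> w; rewrite lee_fin (tv_ge0 h_total).
- by move=> w; apply: sume_ge0 => j _; rewrite lee_fin (tv_ge0 h_total).
- by rewrite mulr_ge0// (tv_ge0 h_total).
move=> w; rewrite adde0 sumEFin -EFinD lee_fin -hy.
have := tv_cat_le y [seq Z i w | i <- iota 0 k].
rewrite big_map size_map size_iota -[in k%:R](prednK k0) mulrS mulrDl mul1r.
have := tv_mono h_total (subvector_catr y [seq Z i w | i <- iota 0 k]).
lra.
Qed.

Let score_le i j : (i <= j)%N -> (score i <= score j)%E.
Proof.
move=> ij; apply: ge0_le_integral => //.
- by move=> w _; rewrite lee_fin (tv_ge0 h_total).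
- by apply: tv_measurableE => a; exact: measurable_funPT.
- by apply: tv_measurableE => a; exact: measurable_funPT.
- move=> w _; rewrite lee_fin (tv_mono h_total)// -(subnKC ij) iotaD map_cat.
  exact: subvector_catl.
Qed.

Lemma next_value_nil_le_score : (0 < k)%N -> (next_value [::] <= score k)%E.
Proof.
move=> k0; rewrite -(integral_next_value [::] k0).
exact: le_trans (score_le k0).
Qed.

Hypothesis Z_indep : mutually_independent (fun j : 'I_k => Z j).

(** Copy number j (from 0) is independent of the copies before it, all of which have indices in
    'I_k. *)
Let score_next j : (j < k)%N ->
  score j.+1 = (\int[Q]_w next_value [seq Z i w | i <- iota 0 j])%E.
Proof.
move=> jk; pose l := [seq widen_ord (ltnW jk) a | a <- enum 'I_j].
have lE w : [seq Z i w | i <- iota 0 j] = [seq Z i w | i : 'I_k <- l].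
  by rewrite -map_comp -val_enum_ord -map_comp.
have l_uniq : uniq l.
  by rewrite map_inj_uniq ?enum_uniq// => a b /(congr1 val) /= ab; exact: val_inj.
have jl : Ordinal jk \notin l.
  apply/mapP => -[a _ /(congr1 val) /= ja].
  by have := ltn_ord a; rewrite -ja ltnn.
under [RHS]eq_integral do rewrite lE.
rewrite -(integral_rcons_indep Z_indep l_uniq jl) => [|E mE]; last exact: Z_law.
apply: eq_integral => w _; congr (h _)%:E.
by rewrite -lE -[j.+1]addn1 iotaD map_cat cats1.
Qed.

Variables (y : seq R) (D : R).
Hypothesis hy_gt0 : 0 < h y.
Hypothesis D_ge0 : 0 <= D.
Hypothesis yP : forall x z, (size x <= k)%N -> h x <= h y ->
  h (rcons y z) + h x <= h (rcons x z) + h y.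
Hypothesis yD : next_value y = (h y + D)%:E.

(* Instead of Markov's inequality, [D] times the indicator of [h x <= h y] is
   bounded below by the affine function [D * (1 - h x / h y)]. *)
Let next_value_affine x : (size x <= k)%N ->
  ((h x + D)%:E <= next_value x + (D / h y * h x)%:E)%E.
Proof.
move=> xk; have [hxy|hyx] := leP (h x) (h y).
  apply: (@le_trans _ _ (next_value x)); last first.
    by apply: leeDl; rewrite lee_fin mulr_ge0 ?divr_ge0 ?(tv_ge0 h_total).
  have := next_value_le (fun z => yP z xk hxy).
  rewrite yD; case: (next_value x) => [b| |]; rewrite ?leey// -!EFinD !lee_fin.
  by lra.
rewrite EFinD leeD ?next_value_ge// lee_fin.
by rewrite mulrAC ler_pdivlMr// ler_wpM2l// ltW.
Qed.

(** Averaging [next_value_affine] over the first j copies, the next copy adds at least D (1 - score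
    j / h y). This is at least D / 2, since score j <= score k <= h y / 2. *)
Lemma increment_le_score : (score k <= (h y / 2)%:E)%E ->
  ((k%:R * (D / 2))%:E <= score k)%E.
Proof.
move=> sk; suff step j : (j <= k)%N -> ((j%:R * (D / 2))%:E <= score j)%E.
  exact: step.
elim: j => [_|j IH jk].
  by rewrite mul0r integral_ge0// => w _; rewrite lee_fin (tv_ge0 h_total).
have sj : (score j <= (h y / 2)%:E)%E := le_trans (score_le (ltnW jk)) sk.
have sj0 : (0 <= score j)%E.
  by rewrite integral_ge0// => w _; rewrite lee_fin (tv_ge0 h_total).
have sjfin : score j \is a fin_num.
  by rewrite ge0_fin_numE// (le_lt_trans sj)// ltry.
have mh : measurable_fun setT (fun w => (h [seq Z i w | i <- iota 0 j])%:E).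
  by apply: tv_measurableE => a; exact: measurable_funPT.
have mn : measurable_fun setT (fun w => next_value [seq Z i w | i <- iota 0 j]).
  by apply: next_value_measurable => a; exact: measurable_funPT.
have Dh0 : 0 <= D / h y by rewrite divr_ge0// ltW.
have : (score j + D%:E <= score j.+1 + (D / h y)%:E * score j)%E.
  rewrite score_next// -ge0_integralZl_EFin//; last first.
    by move=> w _; rewrite lee_fin (tv_ge0 h_total).
  rewrite -ge0_integralD//; last 3 first.
  - by move=> w _; apply: le_trans (next_value_ge _); rewrite lee_fin (tv_ge0 h_total).
  - by move=> w _; rewrite -EFinM lee_fin mulr_ge0// (tv_ge0 h_total).
  - exact: measurable_funeM.
  rewrite -[leRHS]adde0; apply: le_integralD_cst => //.
  - by apply: emeasurable_funD => //; exact: measurable_funeM.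
  - by move=> w; rewrite lee_fin (tv_ge0 h_total).
  - move=> w; apply: adde_ge0; last by rewrite -EFinM lee_fin mulr_ge0// (tv_ge0 h_total).
    by apply: le_trans (next_value_ge _); rewrite lee_fin (tv_ge0 h_total).
  - move=> w; rewrite adde0 -EFinD -EFinM; apply: next_value_affine.
    by rewrite size_map size_iota ltnW.
(* The score of j copies is finite, so it can be cancelled; the score of j + 1 copies may a priori
   be +oo, where the claim is trivial. *)
move: sj sj0 (IH (ltnW jk)); rewrite -(fineK sjfin); set a := fine _.
case: (score j.+1) => [b| |]; rewrite ?leey// -EFinM -!EFinD !lee_fin => sj sj0 IHj H.
have : D / h y * a <= D / 2.
  rewrite (le_trans (ler_wpM2l Dh0 sj))// mulrA divfK// gt_eqF//.
rewrite -[j.+1]addn1 natrD mulrDl mul1r; lra.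
Qed.

End Replication.

End Law.
End TotalValue.

(** * Utilities of sets of items *)

Lemma perm_enum_setU1 (I : finType) (i : I) (S : {set I}) : i \notin S ->
  perm_eq (enum (i |: S)%SET) (rcons (enum S) i).
Proof.
move=> iS; apply: uniq_perm; first exact: enum_uniq.
  by rewrite rcons_uniq mem_enum iS enum_uniq.
by move=> j; rewrite mem_rcons !inE !mem_enum !inE.
Qed.

Lemma perm_enum_setID (I : finType) (S A : {set I}) :
  perm_eq (enum S) (enum (S :&: A)%SET ++ enum (S :\: A)%SET).
Proof.
apply: uniq_perm; first exact: enum_uniq.
  rewrite cat_uniq !enum_uniq andbT; apply/hasPn => i.
  by rewrite !mem_enum !inE => /andP[/negPf-> _]; rewrite andbF.
by move=> i; rewrite mem_cat !mem_enum !inE; case: (i \in A); rewrite ?andbT ?andbF ?orbF.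
Qed.

Section Utility.
Context (R : realType) (d : measure_display) (T : measurableType d).
Context (P : probability T R) (n : nat) (X : 'I_n -> {RV P >-> R}).
Hypothesis X_indep : mutually_independent X.
Variable h : seq R -> R.
Hypothesis h_total : total_value_function h.
Implicit Types S A O : {set 'I_n}.

Local Notation u := (utility X h).
Local Notation nv i := (next_value h (distribution P (X i))).

Lemma utilityE S : u S = (\int[P]_w (h [seq X i w | i <- enum S])%:E)%E.
Proof. by rewrite /utility unlock. Qed.

Let measurable_utility (l : seq 'I_n) :
  measurable_fun setT (fun w => (h [seq X i w | i <- l])%:E).
Proof. by apply: tv_measurableE => // i; exact: measurable_funPT. Qed.

Let h_ge0 x : (0 <= (h x)%:E)%E.
Proof. by rewrite lee_fin (tv_ge0 h_total). Qed.

Lemma utility_ge0 S : (0 <= u S)%E.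
Proof. by rewrite utilityE integral_ge0. Qed.

Lemma utility_le S A : S \subset A -> (u S <= u A)%E.
Proof.
move=> SA; rewrite !utilityE; apply: ge0_le_integral => //.
move=> w _; rewrite lee_fin (tv_mono h_total)//.
exact: (subvector_enum (fun i => X i w)).
Qed.

(** Subadditivity for the split of S along A, then monotonicity from S :&: A to A. *)
Lemma utility_le_setD S A : (u S <= u A + u (S :\: A)%SET)%E.
Proof.
rewrite !utilityE -ge0_integralD//; apply: ge0_le_integral => //.
  exact: emeasurable_funD.
move=> w _; rewrite -EFinD lee_fin.
rewrite (tv_perm h_total (perm_map (fun i => X i w) (perm_enum_setID S A))).
rewrite map_cat (le_trans (tv_subadditive h_total _ _))// lerD2r.
rewrite (tv_mono h_total)//; apply: (subvector_enum (fun i => X i w)).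
exact: subsetIr.
Qed.

Lemma utility_set1 i : u [set i]%SET = nv i [::].
Proof.
rewrite utilityE enum_set1 /= /next_value ge0_integral_pushforward//.
exact: (tv_measurable_rcons_cst h_total [::]).
Qed.

Lemma utility_setU1 i S : i \notin S ->
  u (i |: S)%SET = (\int[P]_w nv i [seq X j w | j <- enum S])%E.
Proof.
move=> iS; rewrite utilityE.
have iE : i \notin enum S by rewrite mem_enum.
rewrite -(integral_rcons_indep h_total X_indep (enum_uniq _) iE)//.
apply: eq_integral => w _; congr EFin.
by rewrite (tv_perm h_total (perm_map (fun i => X i w) (perm_enum_setU1 iS))) map_rcons.
Qed.

(** The pointwise hypothesis is integrated at x = X_S; independence of X_i and X_S turns the
    expected [next_value] into the utility of i |: S. *)
Lemma utility_setU1_ge i S (k : nat) (tau : R) : (0 < k)%N -> 0 <= tau ->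
    i \notin S ->
    (forall x, tau%:E + (k.-1%:R * h x)%:E <= k%:R%:E * nv i x)%E ->
  (k.-1%:R%:E * u S + tau%:E <= k%:R%:E * u (i |: S)%SET)%E.
Proof.
move=> k0 tau0 iS nvP.
have mn : measurable_fun setT (fun w => nv i [seq X j w | j <- enum S]).
  by apply: next_value_measurable => // j; exact: measurable_funPT.
have nv0 x : (0 <= nv i x)%E by apply: le_trans (next_value_ge h_total _ _).
rewrite utility_setU1// utilityE -!ge0_integralZl_EFin//.
rewrite -[leRHS]adde0; apply: le_integralD_cst => //.
- exact: measurable_funeM.
- exact: measurable_funeM.
- by move=> w; rewrite mule_ge0.
- by move=> w; rewrite mule_ge0// lee_fin.
- by move=> w; rewrite adde0 addeC -EFinM.
Qed.

(** By [utility_setU1_ge], adding i multiplies the gap tau - u by at most 1 - 1/k_i; for the empty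
    set the gap is at most tau. *)
Lemma utility_ge_prod S (k : 'I_n -> nat) (tau : R) : 0 <= tau ->
    (forall i, i \in S -> (0 < k i)%N) ->
    (forall i, i \in S -> forall x,
      tau%:E + ((k i).-1%:R * h x)%:E <= (k i)%:R%:E * nv i x)%E ->
  ((tau * (1 - \prod_(i in S) (1 - (k i)%:R^-1)))%:E <= u S)%E.
Proof.
move=> tau0; elim: {S}#|S| {-2}S (erefl #|S|) => [|m IH] S Sm kS nvS.
  move/eqP: Sm; rewrite cards_eq0 => /eqP ->.
  by rewrite big_set0 subrr mulr0 utility_ge0.
have /card_gt0P[i iS] : (0 < #|S|)%N by rewrite Sm.
have iD : i \notin (S :\ i)%SET by rewrite !inE eqxx.
have := utility_setU1_ge (kS _ iS) tau0 iD (nvS _ iS).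
rewrite finset.setD1K//.
have Dm : #|(S :\ i)%SET| = m.
  by apply/eqP; rewrite -eqSS -Sm (cardsD1 i S) iS.
have kD j : j \in (S :\ i)%SET -> (0 < k j)%N by rewrite !inE => /andP[_ /kS].
have {IH} := IH _ Dm kD.
move=> /(_ (fun j jD => nvS j (fintype.subsetP (subsetDl S [set i]%SET) j jD))).
rewrite [in X in _ -> _ -> X](big_setD1 i)//=.
set p := \prod_(_ in _) _.
have := utility_le (subsetDl S [set i]%SET).
have := utility_ge0 (S :\ i)%SET.
case: (u S) => [b| |]; rewrite ?leey//; case: (u _) => [c| |]//.
move: (kS _ iS); case: (k i) => // a _ /= _ _.
rewrite -!EFinM -EFinD !lee_fin -[a.+1]addn1 natrD => IHc H.
have a0 : 0 <= a%:R :> R by exact: ler0n.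
have K0 : 0 < a%:R + 1 :> R by rewrite ltr_wpDl.
(* Here k i = a + 1. Multiplying by it clears the inverse and leaves the induction hypothesis times
   a. *)
rewrite -(ler_pM2l K0); apply: le_trans H.
have -> : (a%:R + 1) * (tau * (1 - (1 - (a%:R + 1)^-1) * p)) =
    a%:R * (tau * (1 - p)) + tau by field; rewrite gt_eqF.
by rewrite lerD2r ler_wpM2l.
Qed.

(** Prepending y to X_O only increases the value, and [tv_cat_le] bounds the result by a sum of
    one-item increments, which is then integrated term by term. *)
Lemma utility_le_sum O (y : seq R) (D : 'I_n -> R) :
    (forall i, i \in O -> nv i y = (h y + D i)%:E) ->
  (u O <= (h y + \sum_(i in O) D i)%:E)%E.
Proof.
move=> yD; rewrite utilityE.
have mX i : measurable_fun setT (fun w => (h (rcons y (X i w)))%:E).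
  rewrite -[y]map_id.
  by apply: (@tv_measurable_rcons _ _ h_total _ _ R y (fun t _ => t)) => // j;
    exact: measurable_cst.
have : (\int[P]_w (h [seq X i w | i <- enum O])%:E + (#|O|%:R * h y)%:E <=
        \int[P]_w (\sum_(i <- enum O) (h (rcons y (X i w)))%:E)%E + (h y)%:E)%E.
  apply: le_integralD_cst => //.
  - exact: emeasurable_sum.
  - by move=> w; apply: sume_ge0.
  - by rewrite mulr_ge0// (tv_ge0 h_total).
  - exact: (tv_ge0 h_total).
  move=> w; rewrite sumEFin -!EFinD lee_fin.
  have := tv_cat_le h_total y [seq X i w | i <- enum O].
  rewrite big_map size_map -cardE.
  have := tv_mono h_total (subvector_catr y [seq X i w | i <- enum O]); lra.
rewrite ge0_integral_sum//.
rewrite (eq_big_seq (fun i => (h y + D i)%:E)); last first.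
  move=> i; rewrite mem_enum => iO; rewrite -yD// /next_value ge0_integral_pushforward//.
  exact: tv_measurable_rcons_cst.
rewrite sumEFin big_enum/= big_split/= sumr_const -[h y *+ _]mulr_natl -EFinD.
case: (integral _ _ _) => [b| |]; rewrite ?leNye// ?leye_eq//.
by rewrite -EFinD !lee_fin; lra.
Qed.

End Utility.

(** * Sums of inverse copy numbers under the budget *)

Section Copies.
Variables (R : realType) (n : nat) (c : 'I_n -> R) (B beta : R).
Hypothesis B_gt0 : 0 < B.
Hypothesis c_bnd : forall i, 0 < c i <= B.
Hypothesis beta_bnd : 0 <= beta <= 1 / 2.
Hypothesis c_beta : beta_small c B beta \/ beta_regular c B beta.

Local Notation copies := (copies c B).

Let c_gt0 i : 0 < c i. Proof. by case/andP: (c_bnd i). Qed.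

Lemma copies_gt0 i : (0 < copies i)%N.
Proof. by rewrite /copies truncn_gt0 ler_pdivlMr// mul1r; case/andP: (c_bnd i). Qed.

Let copies_itv i : (copies i)%:R * c i <= B < ((copies i)%:R + 1) * c i.
Proof.
have /truncn_itv : 0 <= B / c i by rewrite divr_ge0 ?ltW.
by rewrite -/(copies i) ler_pdivlMr// ltr_pdivrMr// -natr1.
Qed.

Let copiesR_gt0 i : 0 < (copies i)%:R :> R.
Proof. by rewrite ltr0n copies_gt0. Qed.

(** Small costs: 1/k_i >= c_i/B, and cost S > B - c_j >= (1 - beta) B. Regular costs: each item
    costs at most B/k_min, so overflowing the budget takes more than k_min items; hence #|S| >=
    k_min and the sum is at least k_min/k_max. *)
Lemma sum_inv_copies_ge (S : {set 'I_n}) j : B < cost c S + c j ->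
  1 - beta <= \sum_(i in S) (copies i)%:R^-1.
Proof.
move=> BSj; case: c_beta => [small|regular].
  apply: (@le_trans _ _ (\sum_(i in S) c i / B)); last first.
    apply: ler_sum => i _; rewrite ler_pdivrMr// mulrC ler_pdivlMr// mulrC.
    by case/andP: (copies_itv i).
  rewrite -mulr_suml -/(cost c S) ler_pdivlMr//.
  by have := small j; lra.
pose iM := [arg max_(i > j) copies i].
pose im := [arg min_(i < j) copies i].
have le_iM i : (copies i <= copies iM)%N.
  by rewrite /iM; case: arg_maxnP => // M _; apply.
have im_le i : (copies im <= copies i)%N.
  by rewrite /im; case: arg_minnP => // M _; apply.
have c_im i : (copies im)%:R * c i <= B.
  by have /andP[+ _] := copies_itv i; apply: le_trans; rewrite ler_pM2r// ler_nat.
have imS : (copies im <= #|S|)%N.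
  rewrite -ltnS -(ltr_nat R) -(ltr_pM2r B_gt0) -natr1 mulrDl mul1r.
  apply: (@lt_le_trans _ _ ((copies im)%:R * (cost c S + c j))).
    by rewrite ltr_pM2l.
  rewrite mulrDr lerD// /cost mulr_sumr mulr_natl -sumr_const.
  exact: ler_sum.
apply: (@le_trans _ _ (\sum_(i in S) (copies iM)%:R^-1)); last first.
  by apply: ler_sum => i _; rewrite lef_pV2 ?posrE// ler_nat.
rewrite sumr_const -[_ *+ _]mulr_natl ler_pdivlMr//.
by apply: le_trans (regular im iM) _; rewrite ler_nat.
Qed.

(** Small costs: k_i c_i > B - c_i >= (1 - beta) B. Regular costs: each item costs more than
    B/(k_max + 1), so #|O| <= k_max, while each k_i is at least (1 - beta) k_max. *)
Lemma sum_inv_copies_le (O : {set 'I_n}) : cost c O <= B ->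
  \sum_(i in O) (copies i)%:R^-1 <= (1 - beta)^-1.
Proof.
move=> OB; have beta1 : 0 < 1 - beta by case/andP: beta_bnd; lra.
case: c_beta => [small|regular].
  apply: (@le_trans _ _ (\sum_(i in O) c i / (B * (1 - beta)))).
    apply: ler_sum => i _; rewrite ler_pdivlMr ?mulr_gt0// mulrC ler_pdivrMr//.
    by have := small i; case/andP: (copies_itv i) => _; lra.
  rewrite -mulr_suml -/(cost c O) invfM mulrA ler_piMl//.
    by rewrite invr_ge0 ltW.
  by rewrite ler_pdivrMr// mul1r.
(* An element of O makes the summed inequality strict, which is what yields #|O| < k_max + 1. *)
have [->|[j jO]] := set_0Vmem O; first by rewrite big_set0 invr_ge0 ltW.
pose iM := [arg max_(i > j) copies i].
have le_iM i : (copies i <= copies iM)%N.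
  by rewrite /iM; case: arg_maxnP => // M _; apply.
have OM : (#|O| <= copies iM)%N.
  rewrite -ltnS -(ltr_nat R) -(ltr_pM2r B_gt0) -natr1.
  apply: (@lt_le_trans _ _ (((copies iM)%:R + 1) * cost c O)); last first.
    by rewrite ler_wpM2l// addr_ge0.
  rewrite /cost mulr_sumr mulr_natl -sumr_const.
  apply: ltr_sum; first by apply/hasP; exists j => //; exact: mem_index_enum.
  move=> i _; have /andP[_ +] := copies_itv i; move/lt_le_trans; apply.
  by rewrite ler_pM2r// lerD2r ler_nat.
apply: (@le_trans _ _ (\sum_(i in O) ((1 - beta) * (copies iM)%:R)^-1)).
  by apply: ler_sum => i _; rewrite lef_pV2 ?posrE ?mulr_gt0.
rewrite sumr_const -[_ *+ _]mulr_natl invfM mulrCA ger_pMr ?invr_gt0//.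
by rewrite ler_pdivrMr// mul1r ler_nat.
Qed.

End Copies.

(** * From the product to the constant p *)

(** By convexity exp(-t) lies below its chord between t = 0 and t = 1, whose slope is -p. *)
Lemma expRN_le_chord (R : realType) (t : R) : 0 <= t <= 1 ->
  expR (- t) <= 1 - t * p_const R.
Proof.
move=> t01.
pose T : {i01 R} := Itv01 (andP t01).1 (andP t01).2.
have := convex_expR T (- 1 : R^o) (0 : R^o).
rewrite !convRE /= mulr0 addr0 expR0 mulr1 mulrN1 => /le_trans; apply.
by rewrite expRN /unstable.onem /p_const; lra.
Qed.

Lemma prod_inv_le (R : realType) (I : finType) (S : {set I}) (k : I -> nat)
    (t : R) :
    (forall i, i \in S -> (0 < k i)%N) -> 0 <= t <= 1 ->
    t <= \sum_(i in S) (k i)%:R^-1 ->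
  \prod_(i in S) (1 - (k i)%:R^-1) <= 1 - t * p_const R.
Proof.
move=> k0 t01 tS; apply: le_trans (expRN_le_chord t01).
apply: (@le_trans _ _ (expR (- \sum_(i in S) (k i)%:R^-1))); last first.
  by rewrite ler_expR lerN2.
rewrite -sumrN expR_sum; apply: ler_prod => i iS.
rewrite expR_ge1Dx subr_ge0 invf_le1 ?ltr0n ?k0//.
by rewrite ler1n k0.
Qed.

(** * Lower and upper bounds on utilities by scores *)

Section Approximation.
Context (R : realType) (d : measure_display) (T : measurableType d).
Context (P : probability T R) (n : nat) (X : 'I_n -> {RV P >-> R}).
Hypothesis X_indep : mutually_independent X.
Variable h : seq R -> R.
Hypothesis h_total : total_value_function h.
Context (d' : measure_display) (T' : measurableType d') (Q : probability T' R).
Variables (Y : 'I_n -> nat -> {RV Q >-> R}) (k : 'I_n -> nat).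
Hypothesis k_gt0 : forall i, (0 < k i)%N.
Hypothesis Y_law : forall i j, (j < k i)%N -> forall E : set R, measurable E ->
  distribution Q (Y i j) E = distribution P (X i) E.
Hypothesis Y_indep : forall i, mutually_independent (fun j : 'I_(k i) => Y i j).

Local Notation u := (utility X h).
Local Notation r i := (replication_score (Y i) h (k i)).

Let rE i : r i = (\int[Q]_w (h [seq Y i j w | j <- iota 0 (k i)])%:E)%E.
Proof. by rewrite /replication_score unlock. Qed.

(** Ensures that the largest outside score is not -oo and lies above h [::], as the intermediate
    value argument requires. *)
Lemma score_ge_nil i : ((h [::])%:E <= r i)%E.
Proof.
rewrite rE; apply: le_trans (next_value_nil_le_score h_total (@Y_law i) (k_gt0 i)).
exact: next_value_ge.
Qed.

Lemma utility_set1_le_score i : (u [set i]%SET <= r i)%E.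
Proof.
rewrite utility_set1// rE.
exact: (next_value_nil_le_score h_total (@Y_law i) (k_gt0 i)).
Qed.

(** The case x = [::] of [score_le_next_value]; it makes the score of an item finite as soon as its
    utility is. *)
Lemma score_le_utility_set1 i : (r i <= (k i)%:R%:E * u [set i]%SET)%E.
Proof.
rewrite utility_set1// rE.
apply: le_trans (score_le_next_value h_total (@Y_law i) [::] (k_gt0 i)).
by apply: leeDl; rewrite lee_fin mulr_ge0// (tv_ge0 h_total).
Qed.

Lemma utility_ge_score (S : {set 'I_n}) (tau t : R) : 0 <= tau -> 0 <= t <= 1 ->
    (forall i, i \in S -> (tau%:E <= r i)%E) ->
    t <= \sum_(i in S) (k i)%:R^-1 ->
  ((tau * (t * p_const R))%:E <= u S)%E.
Proof.
move=> tau0 t01 tauS tS.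
apply: le_trans (utility_ge_prod X_indep h_total (k := k) tau0 _ _) => //.
  rewrite lee_fin ler_wpM2l// lerBrDl -lerBrDr.
  by apply: prod_inv_le.
move=> i iS x; apply: le_trans (score_le_next_value h_total (@Y_law i) x (k_gt0 i)).
by rewrite leeD2r// -rE tauS.
Qed.

(** If h stays below v then so does u O. Otherwise v is a value of h, and extended diminishing
    returns gives y with h y = v. Since r_i <= t <= v / 2, [increment_le_score] bounds each
    increment over y by 2 t / k_i <= v / k_i. *)
Lemma utility_le_score_image (O : {set 'I_n}) (t v : R) :
    (forall i, i \in O -> (r i <= t%:E)%E) -> h [::] <= v -> 0 < v -> 2 * t <= v ->
  (u O <= (v * (1 + \sum_(i in O) (k i)%:R^-1))%:E)%E.
Proof.
move=> rO hv v0 tv.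
have W0 : 0 <= \sum_(i in O) (k i)%:R^-1 :> R.
  by apply: sumr_ge0 => i _; rewrite invr_ge0.
have [[x vx]|] := pselect (exists x, v <= h x); last first.
  move=> /forallNP hlt; apply: (@le_trans _ _ v%:E); last first.
    by rewrite lee_fin ler_pMr// lerDl.
  rewrite utilityE -[leLHS]adde0 -[v%:E]add0e.
  have := @le_integralD_cst R d T P (fun w => (h [seq X i w | i <- enum O])%:E)
    (cst 0%E) 0 v.
  rewrite integral0; apply => //.
  - by apply: tv_measurableE => // i; exact: measurable_funPT.
  - by move=> w; rewrite lee_fin (tv_ge0 h_total).
  - exact: ltW.
  - move=> w; rewrite adde0 add0e lee_fin.
    by have /negP := hlt [seq X i w | i <- enum O]; rewrite -ltNge => /ltW.
have [|x0 hx0] := tv_ivt h_total (x := x) (v := v); first by rewrite hv vx.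
(* The vectors compared with y consist of at most k i copies of one item, so this size bound lets
   one y serve all items. *)
have [y [hy yP]] := tv_edr h_total (\max_i k i) x0.
rewrite hx0 in hy yP.
pose D i := fine (next_value h (distribution P (X i)) y) - v.
have next_ge i := next_value_ge h_total (distribution P (X i)) y.
(* The increment over y is at most the one over the empty vector, and the utility of the single item
   i is at most r_i <= t. *)
have next_fin i : i \in O -> next_value h (distribution P (X i)) y \is a fin_num.
  move=> iO; rewrite ge0_fin_numE; last first.
    by apply: le_trans (next_ge i); rewrite lee_fin (tv_ge0 h_total).
  have := next_value_le h_total (distribution P (X i))
    (fun z => tv_dr h_total z (subvector_catl [::] y)).
  rewrite -utility_set1//.
  have : (u [set i]%SET <= t%:E)%E.
    exact: le_trans (utility_set1_le_score i) (rO _ iO).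
  case: (next_value _ _ y) => [b| |]//; first by rewrite ltry.
  by case: (u _).
have next_D i : i \in O -> next_value h (distribution P (X i)) y = (h y + D i)%:E.
  by move=> iO; rewrite /D hy addrC subrK fineK// next_fin.
rewrite mulrDr mulr1 -{1}hy; apply: le_trans (utility_le_sum h_total next_D) _.
rewrite lee_fin lerD2l mulr_sumr; apply: ler_sum => i iO.
have D0 : 0 <= D i.
  by have := next_ge i; rewrite next_D// lee_fin lerDl.
have ki : (k i <= \max_i k i)%N by exact: leq_bigmax.
have yPi x' z : (size x' <= k i)%N -> h x' <= h y ->
    h (rcons y z) + h x' <= h (rcons x' z) + h y.
  by rewrite hy => xk hx; rewrite -hy; apply: yP => //; exact: leq_trans ki.
have hy0 : 0 < h y by rewrite hy.
have := increment_le_score h_total (@Y_law i) (@Y_indep i) hy0 D0 yPi (next_D _ iO).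
have tv2 : (r i <= (h y / 2)%:E)%E.
  by apply: (le_trans (rO _ iO)); rewrite lee_fin hy; lra.
rewrite -rE => /(_ tv2) kD; have := le_trans kD (rO _ iO); rewrite lee_fin => kDt.
by rewrite ler_pdivlMr ?ltr0n ?k_gt0//; lra.
Qed.

(** The value v = 2 t may be 0, whereas [utility_le_score_image] needs v > 0; so v is taken slightly
    larger, with total excess e, and e tends to 0. *)
Lemma utility_le_score (O : {set 'I_n}) (t : R) :
    (forall i, i \in O -> (r i <= t%:E)%E) -> h [::] <= t ->
  (u O <= (2 * t * (1 + \sum_(i in O) (k i)%:R^-1))%:E)%E.
Proof.
move=> rO ht; have t0 : 0 <= t := le_trans (tv_ge0 h_total _) ht.
set W := \sum_(i in O) _.
have W1 : 0 < 1 + W.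
  by rewrite ltr_pwDl// sumr_ge0// => i _; rewrite invr_ge0.
apply/lee_addgt0Pr => e e0; have eW : 0 < e / (1 + W) by exact: divr_gt0.
apply: le_trans (utility_le_score_image (v := 2 * t + e / (1 + W)) rO _ _ _) _.
- by lra.
- by lra.
- by lra.
- by rewrite -EFinD lee_fin -/W mulrDl divfK// gt_eqF.
Qed.

End Approximation.

(** * The approximation ratio and the theorem *)

Lemma greedy_fill_sup (R : realType) (n : nat) (c : 'I_n -> R) (B : R)
    (S : {set 'I_n}) (l : seq 'I_n) : S \subset greedy_fill c B S l.
Proof.
rewrite /greedy_fill; elim: l S => //= i l IH S.
by case: ifP => _; [apply: fintype.subset_trans (IH _); exact: finset.subsetUr|exact: IH].
Qed.

Lemma approx_ratio_le (R : realType) (eps beta t U a : R) :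
    0 <= eps < 1 -> 0 <= beta < 1 / 2 -> 0 <= a ->
    (1 - eps) * t * ((1 - beta) * p_const R) <= a ->
    U <= a + 2 * t * (1 + (1 - beta)^-1) ->
  (approx_ratio eps beta * U%:E <= a%:E)%E.
Proof.
move=> /andP[eps0 eps1] /andP[beta0 beta1] a0 ta Ua.
have p0 : 0 < p_const R.
  by rewrite subr_gt0 invf_lt1 ?expR_gt0// -[ltLHS]expR0 ltr_expR.
have b2 : 0 < 1 - 2 * beta by lra.
have b1 : 0 < 1 - beta by lra.
rewrite /approx_ratio; set e := (1 - eps) * p_const R.
have e0 : 0 < e by rewrite mulr_gt0// subr_gt0.
(* The factors of q are (4 - beta) / (1 - beta) and (1 - beta) / (1 - 2 beta). *)
have qE : q_const beta = ((4 - beta) / (1 - 2 * beta))%:E.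
  rewrite /q_const inver gt_eqF//.
  by congr EFin; field; rewrite !gt_eqF.
set q := (4 - beta) / (1 - 2 * beta) in qE.
have q0 : 0 < q by rewrite divr_gt0//; lra.
rewrite qE -EFinD inver gt_eqF ?addr_gt0// -!EFinM lee_fin.
rewrite mulrAC ler_pdivrMr ?addr_gt0//.
have ta' : e * t * (1 - beta) <= a by rewrite /e; lra.
(* By [ta'], e times the upper bound on the part of OPT outside the prefix is at most a G, so e U <=
   a (e + G). *)
pose G := 2 * (1 + (1 - beta)^-1) / (1 - beta).
have Gq : G <= q.
  rewrite /q ler_pdivlMr// /G mulrAC ler_pdivrMr//.
  have -> : 2 * (1 + (1 - beta)^-1) * (1 - 2 * beta) =
    2 * (2 - beta) * (1 - 2 * beta) / (1 - beta) by field; rewrite gt_eqF.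
  (* The difference of the two sides is beta + 2 beta^2 - beta^3. *)
  rewrite ler_pdivrMr//; nra.
have G0 : 0 <= G by rewrite divr_ge0 ?(ltW b1)// mulr_ge0// addr_ge0// invr_ge0 ltW.
have eU : e * U <= e * (a + 2 * t * (1 + (1 - beta)^-1)) by rewrite ler_pM2l.
apply: le_trans eU _.
have -> : e * (a + 2 * t * (1 + (1 - beta)^-1)) = a * e + e * t * (1 - beta) * G.
  by rewrite /G; field; rewrite gt_eqF.
by rewrite [a * (e + q)]mulrDr lerD2l (le_trans (ler_wpM2r G0 ta'))// ler_wpM2l.
Qed.

Theorem theorem2 (R : realType)
  (d : measure_display) (T : measurableType d) (P : probability T R)
  (n : nat) (X : 'I_n -> {RV P >-> R})
  (X_ge0 : forall i w, 0 <= X i w)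
  (X_indep : mutually_independent X)
  (g : seq R -> R)
  (g_ge0 : nonneg_valued g)
  (g_pad : zero_padding g)
  (g_sym : forall m : nat, (n <= m)%N -> symmetric_value m g)
  (g_mono : forall m : nat, (n <= m)%N -> monotone_value m g)
  (g_cont : forall m : nat, (n <= m)%N -> continuous_value m g)
  (g_edr : forall m : nat, (n <= m)%N -> extended_diminishing_returns m g)
  (B : R) (B_gt0 : 0 < B)
  (c : 'I_n -> R) (c_bnd : forall i, 0 < c i <= B)
  (beta : R) (beta_bnd : 0 <= beta <= 1 / 2)
  (c_beta : beta_small c B beta \/ beta_regular c B beta)
  (d' : measure_display) (T' : measurableType d') (Q : probability T' R)
  (Y : 'I_n -> nat -> {RV Q >-> R})
  (Y_copies : forall i, independent_copies (X i) (copies c B i) (Y i))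
  (rhat : 'I_n -> R) (eps : R) (eps_bnd : 0 <= eps < 1)
  (s : 'S_n) (s_sort : sorted_by rhat s)
  (k : 'I_n) (k_crit : critical_index c B s k)
  (acc : accurate (fun i => replication_score (Y i) g (copies c B i)) eps s k)
  (A : {set 'I_n})
  (A_out : algorithm_output c B (utility X g) s k A)
  (OPT : {set 'I_n}) (OPT_opt : optimal c B (utility X g) OPT) :
  (approx_ratio eps beta * utility X g OPT <= utility X g A)%E.
Proof.
pose h := g \o @pos_vec R.
have h_total : total_value_function h
  by exact: (total_value_pos g_ge0 g_pad g_mono g_cont g_edr).
have uE : utility X g = utility X h.
  apply/funext => S; congr expectation; apply/funext => w.
  by rewrite /h /= pos_vec_id// => _ /mapP[i _ ->].
have rE i : replication_score (Y i) g (copies c B i) =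
    replication_score (Y i) h (copies c B i).
  congr expectation; apply/funext => w; rewrite /h /= pos_vec_id//.
  move=> _ /mapP[j + ->]; rewrite mem_iota add0n => jk.
  by have [+ _ _] := Y_copies i; apply.
have k_gt0 := copies_gt0 c_bnd.
have Y_law i j (jk : (j < copies c B i)%N) (E : set R) (mE : measurable E) :
    distribution Q (Y i j) E = distribution P (X i) E.
  by have [_ + _] := Y_copies i; apply.
have Y_indep i : mutually_independent (fun j : 'I_(copies c B i) => Y i j).
  by have [_ _] := Y_copies i.
rewrite uE in A_out OPT_opt *.
have {}acc (a : 'I_n) : (a <= k)%N -> ((1 - eps)%:E *
    \big[maxe/-oo]_(j < n | (k <= j)%N) replication_score (Y (s j)) h (copies c B (s j))
    <= replication_score (Y (s a)) h (copies c B (s a)))%E.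
  by move=> /acc; rewrite rE; under eq_bigr do rewrite rE.
set S := [set s i | i : 'I_n & (i < k)%N]%SET.
have SA : (utility X h S <= utility X h A)%E.
  by case: A_out => _ + _; apply: le_trans; apply: utility_le => //; exact: greedy_fill_sup.
have costS : cost c S = \sum_(i < n | (i < k)%N) c (s i).
  rewrite /cost big_imset/=; last by move=> i j _ _; exact: perm_inj.
  by apply: eq_bigl => i; rewrite inE.
have [/andP[beta0 beta1] /andP[eps0 eps1]] := (beta_bnd, eps_bnd).
have SV : 1 - beta <= \sum_(i in S) (copies c B i)%:R^-1.
  (* Adding the critical item s k to the prefix S exceeds the budget. *)
  apply: (sum_inv_copies_ge (j := s k) B_gt0 c_bnd c_beta).
  case/andP: k_crit => _; rewrite (bigD1 k)//= addrC costS.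
  move=> /lt_le_trans; apply; rewrite lerD2r le_eqVlt; apply/orP; left; apply/eqP.
  by apply: eq_bigl => i; rewrite ltn_neqAle andbC.
have S_prefix : {in S, forall i, exists2 a : 'I_n, (a < k)%N & i = s a}.
  by move=> i /imsetP[a]; rewrite inE => ak ->; exists a.
have [->|] := eqVneq (utility X h A) +oo%E; first by rewrite leey.
rewrite -ltey => A_fin.
have S_fin := le_lt_trans SA A_fin.
(* S is nonempty since its sum of inverses is at least 1 - beta > 0. The finite score of i1 will
   make tau finite. *)
have [S0|[i1 i1S]] := set_0Vmem S.
  by exfalso; move: SV; rewrite S0 big_set0; lra.
have [a1 a1k i1E] := S_prefix _ i1S.
set tau := (\big[maxe/-oo]_(j < n | _) _)%E in acc.
have r_tau (j : 'I_n) : (k <= j)%N ->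
    (replication_score (Y (s j)) h (copies c B (s j)) <= tau)%E.
  by move=> kj; rewrite /tau; exact: (le_bigmax_cond _ _ kj).
have tau_nil : ((h [::])%:E <= tau)%E.
  exact: le_trans (score_ge_nil h_total k_gt0 Y_law (s k)) (r_tau k (leqnn k)).
have r1_fin : (replication_score (Y i1) h (copies c B i1) < +oo)%E.
  apply: le_lt_trans (score_le_utility_set1 h_total k_gt0 Y_law i1) _.
  apply: lte_mul_pinfty => //.
  by apply: le_lt_trans S_fin; apply: utility_le => //; rewrite finset.sub1set.
have eps_gt0 : 0 < 1 - eps by rewrite subr_gt0.
(* If tau were +oo, accuracy with 1 - eps > 0 would make the score of i1 infinite. *)
have [t tauE] : exists t, tau = t%:E.
  move: tau_nil (acc _ (ltnW a1k)); rewrite -i1E.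
  case: (tau) => [t| |] //; first by exists t.
  by rewrite gt0_muley ?lte_fin// leye_eq => _ /eqP r1; rewrite r1 in r1_fin.
rewrite tauE in tau_nil acc r_tau.
rewrite lee_fin in tau_nil.
have t0 : 0 <= t := le_trans (tv_ge0 h_total _) tau_nil.
have lower : (((1 - eps) * t * ((1 - beta) * p_const R))%:E <= utility X h S)%E.
  apply: (utility_ge_score X_indep h_total k_gt0 Y_law _ _ _ SV).
  - by rewrite mulr_ge0// ltW.
  - by apply/andP; split; lra.
  - by move=> i /S_prefix[a ak ->]; rewrite EFinM; exact: acc (ltnW ak).
have OPT_le : cost c (OPT :\: S)%SET <= B.
  case: OPT_opt => OB _; apply: le_trans OB.
  rewrite /cost [leRHS](big_setID S)/= lerDr sumr_ge0// => i _.
  by case/andP: (c_bnd i) => /ltW.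
have upper : (utility X h (OPT :\: S)%SET <=
    (2 * t * (1 + (1 - beta)^-1))%:E)%E.
  apply: le_trans (utility_le_score h_total k_gt0 Y_law Y_indep _ tau_nil) _.
    (* An item outside S has a 0-based label at least k, so its score is among those bounded by
       t. *)
    move=> i; rewrite inE => /andP[iS _]; rewrite -(permKV s i).
    apply: r_tau; rewrite leqNgt; apply: contra iS => ik.
    by apply/imsetP; exists (s^-1 i)%g; rewrite ?inE ?permKV.
  rewrite lee_fin ler_wpM2l ?mulr_ge0// lerD2l.
  exact: (sum_inv_copies_le B_gt0 c_bnd beta_bnd c_beta).
have OPT_bound := le_trans (utility_le_setD X h_total OPT S) (leeD SA upper).
have lowerA := le_trans lower SA.
have A_ge0 := utility_ge0 X h_total A.
have A_num : utility X h A \is a fin_num by rewrite ge0_fin_numE.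
rewrite -(fineK A_num) -EFinD in OPT_bound.
have OPT_num : utility X h OPT \is a fin_num.
  by rewrite ge0_fin_numE ?utility_ge0// (le_lt_trans OPT_bound)// ltry.
rewrite -(fineK A_num) lee_fin in lowerA.
rewrite -(fineK A_num) lee_fin in A_ge0.
rewrite -(fineK OPT_num) lee_fin in OPT_bound.
rewrite -(fineK A_num) -(fineK OPT_num).
have [beta_lt|beta_ge] := ltP beta (1 / 2).
  by apply: (approx_ratio_le (t := t)) => //; apply/andP.
(* At this endpoint q = +oo, so the ratio is 0 and u(A) >= 0 suffices. *)
have -> : beta = 1 / 2 by apply/le_anti/andP.
have q_oo : q_const (1 / 2 : R) = +oo%E.
  rewrite /q_const (_ : 1 - 2 * (1 / 2) = 0 :> R); last by lra.
  have half_gt0 : (0 < (1 / 2 : R)%:E)%E by rewrite lte_fin; lra.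
  rewrite inver eqxx gt0_muley// addey// gt0_muley// lte_fin.
  by rewrite addr_gt0// divr_gt0; lra.
by rewrite /approx_ratio q_oo addey// invey mule0 mul0e lee_fin.
Qed.
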